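(* Let $K\subset\mathbb R^2$ be a convex body with boundary of class $C^2$. Suppose that the identity $$\frac{\sin^3\alpha}{\kappa(s)}=\frac{\sin^3\beta}{\kappa(t)}$$ holds for every chord $[\gamma(s),\gamma(t)]$ in some open set $U$ of chords of $K$ that covers $\partial K$ (every point of $\partial K$ is an endpoint of some chord in $U$). Then $K$ is an ellipse.
   Context: A convex body is a compact convex set with non-empty interior; $\gamma$ is a regular parametrization of $\partial K$ and $\kappa(s)$ is the curvature of $\partial K$ at $\gamma(s)$. For a chord with endpoints $\gamma(s),\gamma(t)$, $\alpha$ is the angle between the chord and the tangent line to $\partial K$ at $\gamma(s)$ and $\beta$ is the angle between the chord and the tangent line to $\partial K$ at $\gamma(t)$. Chords are identified with pairs of boundary points, and ''open'' refers to this topology. *)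

(* Defs.v *)
From HB Require Import structures.
From mathcomp Require Import all_boot all_order all_algebra.
From mathcomp Require Import all_classical all_reals all_analysis.
Set Implicit Arguments. Unset Strict Implicit. Unset Printing Implicit Defensive.
Import Order.TTheory GRing.Theory Num.Theory.
Import numFieldNormedType.Exports.
Local Open Scope classical_set_scope.
Local Open Scope ring_scope.

Section Plane.
Variable R : realType.
Definition pt := (R * R)%type.

Definition psub (p q : pt) : pt := (p.1 - q.1, p.2 - q.2).
Definition dot (u v : pt) : R := u.1 * v.1 + u.2 * v.2.
Definition cross (u v : pt) : R := u.1 * v.2 - u.2 * v.1.
Definition enorm (u : pt) : R := Num.sqrt (dot u u).

Definition convex_set (K : set pt) : Prop :=
  forall p q (l : R), K p -> K q -> 0 <= l -> l <= 1 ->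
    K (l * p.1 + (1 - l) * q.1, l * p.2 + (1 - l) * q.2).

Definition convex_body (K : set pt) : Prop :=
  compact K /\ convex_set K /\ (exists x, (K°) x).

Definition bdry (K : set pt) : set pt := closure K `\` K°.

Definition C2fun (f : R -> R) : Prop :=
  (forall x, derivable f x 1) /\ (forall x, derivable (derive1 f) x 1) /\
  continuous (derive1 (derive1 f)).

Definition curve (g1 g2 : R -> R) (s : R) : pt := (g1 s, g2 s).
Definition tangent (g1 g2 : R -> R) (s : R) : pt := (derive1 g1 s, derive1 g2 s).
Definition accel (g1 g2 : R -> R) (s : R) : pt :=
  (derive1 (derive1 g1) s, derive1 (derive1 g2) s).

Definition C2_regular_param (K : set pt) (g1 g2 : R -> R) : Prop :=
  C2fun g1 /\ C2fun g2 /\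
  (forall s, tangent g1 g2 s <> (0, 0)) /\
  exists L : R, 0 < L /\
    (forall s, curve g1 g2 (s + L) = curve g1 g2 s) /\
    (forall s t, 0 <= s < L -> 0 <= t < L ->
       curve g1 g2 s = curve g1 g2 t -> s = t) /\
    (forall p, bdry K p <-> exists s, curve g1 g2 s = p).

Definition curvature (g1 g2 : R -> R) (s : R) : R :=
  `|cross (tangent g1 g2 s) (accel g1 g2 s)| / (enorm (tangent g1 g2 s)) ^+ 3.

(* angle in [0, pi/2] between the lines spanned by nonzero vectors u, v *)
Definition line_angle (u v : pt) : R :=
  acos (`|dot u v| / (enorm u * enorm v)).

(* chords of K, identified with (ordered) pairs of distinct boundary points *)
Definition chord (K : set pt) (p q : pt) : Prop :=
  bdry K p /\ bdry K q /\ p <> q.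

(* U is an open set of chords (for the topology of pairs of boundary points) *)
Definition open_chord_set (K : set pt) (U : set (pt * pt)) : Prop :=
  (forall c, U c -> chord K c.1 c.2) /\
  (forall c, U c -> exists e : R, 0 < e /\
     forall p q, chord K p q -> enorm (psub p c.1) < e ->
       enorm (psub q c.2) < e -> U (p, q)).

Definition covers_bdry (K : set pt) (U : set (pt * pt)) : Prop :=
  forall p, bdry K p -> exists q, U (p, q) \/ U (q, p).

Definition is_ellipse (K : set pt) : Prop :=
  exists (x0 y0 a b c : R), 0 < a /\ 0 < a * c - b ^+ 2 /\
    K = [set p : pt | a * (p.1 - x0) ^+ 2 + 2 * b * (p.1 - x0) * (p.2 - y0)
                       + c * (p.2 - y0) ^+ 2 <= 1].
End Plane.

(* Main.v *)
Require Import Defs.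
From HB Require Import structures.
From mathcomp Require Import all_boot all_order all_algebra.
From mathcomp Require Import all_classical all_reals all_analysis.
From mathcomp Require Import ring lra.
Import Order.TTheory GRing.Theory Num.Theory.
Import numFieldNormedType.Exports.
Local Open Scope classical_set_scope.
Local Open Scope ring_scope.

(** Write [d = c t - c s], [A = c'(s) x d] and [B = d x c'(t)].  The angle
    condition is equivalent to the affine-invariant identity
    [|A|^3 / |c' x c''|(s) = |B|^3 / |c' x c''|(t)], so that the ratio [A / B]
    is locally a product of a function of [s] and a function of [t]; as [A] and
    [B] are differentiable in [s], the equation may be differentiated at a fixed
    [s0].  With [Y = c'(s0) x d] and [Z = d x c''(s0) + k Y] for a suitable
    constant [k], this yields [Y Y' = B Z], while [Z Y' - Z' Y] is
    [c'(s0) x c''(s0)] times [B]; these two relations say that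
    [(Z^2 - 2 (c'(s0) x c''(s0)) Y) / Y^2] is constant in [t].  Hence every
    boundary point has a neighbourhood in the boundary that lies on a
    nondegenerate conic.  Two such conics agree as soon as they share five
    points, so by connectedness the whole boundary lies on one conic, and a
    compact set with nonempty interior whose boundary lies on a nondegenerate
    conic is a filled ellipse. *)

(** * Rays leaving a closed or compact planar set *)

Section Rays.
Set Implicit Arguments.
Unset Strict Implicit.
Variable R : realType.
Implicit Types (K : set (pt R)) (p v : pt R) (l : R).

Definition ray p v l : pt R := (p.1 + l * v.1, p.2 + l * v.2).

Lemma continuous_ray p v : continuous (ray p v).
Proof.
move=> l.
apply: (@cvg_pair _ _ _ _ (nbhs (p.1 + l * v.1)) (nbhs (p.2 + l * v.2))).
  by apply: cvgD; [exact: cvg_cst|apply: cvgM; [exact: cvg_id|exact: cvg_cst]].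
by apply: cvgD; [exact: cvg_cst|apply: cvgM; [exact: cvg_id|exact: cvg_cst]].
Qed.

Lemma ray0 p v : ray p v 0 = p.
Proof. by case: p => a b; rewrite /ray /= !mul0r !addr0. Qed.

Lemma interior_ray K p v : K° p -> exists2 l, 0 < l & K° (ray p v l).
Proof.
move=> Kp.
have : \forall l \near (0 : R), K° (ray p v l).
  apply: continuous_ray; rewrite ray0.
  by apply: open_nbhs_nbhs; split => //; exact: open_interior.
move=> /nbhs_ballP[e /= e0 He]; exists (e / 2); first by rewrite divr_gt0.
apply: He; rewrite /ball /= sub0r normrN gtr0_norm; lra.
Qed.

(** The supremum of the parameters whose points lie in [K] works: closedness keeps its point in [K],
    and an interior point there would allow a larger parameter. *)
Lemma exit_segment K p v : closed K -> K p -> ~ K (ray p v 1) ->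
  exists2 l, 0 <= l < 1 & bdry K (ray p v l).
Proof.
move=> Kc Kp Kq; pose A := [set l | 0 <= l <= 1 /\ K (ray p v l)].
have A0 : A 0 by split; [lra|rewrite ray0].
have Aub : has_ubound A by exists 1 => l [/andP[]].
have A1 : forall l, A l -> l <= sup A.
  by move=> l Al; apply: sup_upper_bound => //; split => //; exists 0.
have : closure A (sup A) by apply: closure_sup => //; exists 0.
have clA : closed A.
  apply: closedI.
    rewrite (_ : (fun l : R => is_true (0 <= l <= 1)) = `[0, 1]%classic).
      exact: interval_closed.
    by apply/seteqP; split => l /=; rewrite in_itv.
  by apply: preimage_closed => // l _; exact: continuous_ray.
set m := sup A in A1 *; move=> /clA[m01 Km].
have m1 : m != 1 by apply: contra_notN Kq => /eqP <-.
exists m; first lra.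
split; first exact: subset_closure.
move=> Km'.
have : \forall l \near m, K (ray p v l).
  by apply: continuous_ray.
move=> /nbhs_ballP[e /= e0 He].
have [x [mx x1 xe]] : exists x, [/\ m < x, x <= 1 & x <= m + e / 2].
  exists (Num.min (m + e / 2) 1).
  by rewrite lt_min !ge_min !lexx orbT; split => //; lra.
suff : A x by move/A1; lra.
split; first lra.
by apply: He; rewrite /ball /= ltr0_norm; lra.
Qed.

(** A compact set is bounded, so a far point of the ray is outside and [exit_segment] applies; the
    parameter is nonzero because [p] is interior. *)
Lemma exit_ray K p v : compact K -> K° p -> v <> (0, 0) ->
  exists2 l, 0 < l & bdry K (ray p v l).
Proof.
move=> Kc Kp v0.
have clK : closed K by apply: compact_closed => //; exact: norm_hausdorff.
have [M [Mr HM]] := compact_bounded Kc.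
have [N N0 KN] : exists2 N : R, 0 < N & ~ K (ray p (N * v.1, N * v.2) 1).
  have /HM {}HM : M < `|M| + 1 by have := ler_norm M; lra.
  pose B := `|M| + 1.
  have nv : 0 < `|v|.
    by rewrite normr_gt0; apply/eqP => v00; apply: v0; rewrite v00.
  (* This gives [N * v] the norm [B + |p| + 1], so by the triangle inequality the far point has norm
     above [B]. *)
  exists ((B + `|p| + 1) / `|v|).
    by rewrite divr_gt0 // /B; have := normr_ge0 p; have := normr_ge0 M; lra.
  move=> /HM; rewrite -/B.
  set N := _ / _ => H.
  have N0 : 0 <= N.
    by rewrite /N divr_ge0 // /B; have := normr_ge0 p; have := normr_ge0 M; lra.
  have E : `|N *: (v : R * R)| = B + `|p| + 1.
    by rewrite normrZ ger0_norm // /N divfK // gt_eqF.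
  have := ler_normB (ray p (N * v.1, N * v.2) 1) p.
  rewrite (_ : _ - _ = N *: (v : R * R)); last first.
    by case: (v) => a b; rewrite /ray; congr pair => /=; rewrite mul1r addrC addKr.
  rewrite E => H'; have := le_trans H' (lerD H (lexx `|p|)); lra.
have [l l01 bl] := exit_segment clK (interior_subset Kp) KN.
have E : ray p (N * v.1, N * v.2) l = ray p v (l * N).
  by rewrite /ray /= !mulrA.
exists (l * N); last by rewrite -E.
rewrite pmulr_lgt0 // lt_neqAle eq_sym (andP l01).1 andbT.
by apply/eqP => l0; move: bl; rewrite l0 ray0 => -[].
Qed.
End Rays.

(** * Conics in affine coordinates: normal form and uniqueness *)

Section Conics.
Set Implicit Arguments.
Unset Strict Implicit.
Variable R : realType.
Implicit Types (K : set (pt R)) (p q v y z : pt R).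

Definition aff (c : R) z p : R := c + dot z p.

Lemma aff_ray c z p v l : aff c z (ray p v l) = aff c z p + l * dot z v.
Proof. by rewrite /aff /ray /dot /=; ring. Qed.

Lemma dual_vector y z (a b : R) : cross z y != 0 ->
  exists v, dot z v = a /\ dot y v = b.
Proof.
rewrite /cross => D0.
exists ((a * y.2 - b * z.2) / cross z y, (b * z.1 - a * y.1) / cross z y).
by rewrite /dot /cross /=; split; field.
Qed.

(** Normal form [Z^2 - Y - C Y^2] of a conic tangent to the line [Y = 0] at the point [Z = Y = 0];
    it is nondegenerate when [cross z y != 0]. The coefficient [C] will be a constant of
    integration. *)
Definition conic (z0 y0 C : R) z y p : R :=
  aff z0 z p ^+ 2 - aff y0 y p - C * aff y0 y p ^+ 2.

(** As [z] and [y] are independent, the two affine forms are coordinates of the plane, and any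
    affine function is an affine combination of them. *)
Lemma conic_affine_change (z0 y0 : R) z y (w0 x0 C' : R) (w x : pt R) : cross z y != 0 ->
  exists a b c d e f : R, forall p, conic w0 x0 C' w x p =
    a * aff z0 z p ^+ 2 + b * aff z0 z p * aff y0 y p + c * aff y0 y p ^+ 2
    + d * aff z0 z p + e * aff y0 y p + f.
Proof.
move=> D0.
have lin (u0 : R) (u : pt R) : exists a b c, forall p,
    aff u0 u p = a * aff z0 z p + b * aff y0 y p + c.
  exists (cross u y / cross z y), (cross z u / cross z y).
  exists (u0 - cross u y / cross z y * z0 - cross z u / cross z y * y0).
  by move=> p; move: D0; rewrite /aff /dot /cross => D0; field.
have [a [b [c Hw]]] := lin w0 w; have [d [e [f Hx]]] := lin x0 x.
exists (a ^+ 2 - C' * d ^+ 2), (2 * a * b - C' * 2 * d * e),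
  (b ^+ 2 - C' * e ^+ 2), (2 * a * c - d - C' * 2 * d * f),
  (2 * b * c - e - C' * 2 * e * f), (c ^+ 2 - f - C' * f ^+ 2).
by move=> p; rewrite /conic Hw Hx; ring.
Qed.

(* The points of the conic off the line [y = 0] are parametrized rationally by
   the slope [u = z / y], through [y (u^2 - C) = 1]; substituting in the other
   conic yields a polynomial of degree at most 4 in [u]. *)
Lemma conic_unique (z0 y0 C : R) z y (w0 x0 C' : R) (w x : pt R) (s : seq (pt R)) :
  cross z y != 0 -> (4 < size s)%N ->
  uniq [seq aff z0 z p / aff y0 y p | p <- s] ->
  (forall p, p \in s -> [/\ aff y0 y p != 0, conic z0 y0 C z y p = 0 &
     conic w0 x0 C' w x p = 0]) ->
  forall p, conic z0 y0 C z y p = 0 -> conic w0 x0 C' w x p = 0.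
Proof.
move=> D0 ss us Hs.
have [a [b [c [d [e [f E]]]]]] := @conic_affine_change z0 y0 z y w0 x0 C' w x D0.
(* Coefficients, constant term first, of the second equation divided by [Y^2], after [Z / Y = u] and
   [1 / Y = u^2 - C]. *)
pose P : {poly R} := Poly [:: c - e * C + f * C ^+ 2; b - d * C; a + e - 2 * f * C; d; f].
have P0 : P = 0.
  apply/eqP/negPn/negP => Pn0.
  have := @max_poly_roots _ P [seq aff z0 z p / aff y0 y p | p <- s] Pn0 _ us.
  rewrite size_map => H.
  have : (size s < size P)%N.
    apply: H; apply/allP => _ /mapP[p /Hs[Y0 Q1 Q2] ->].
    rewrite /root horner_Poly /=.
    move: Q2; rewrite E; move: Q1; rewrite /conic.
    set Z := aff z0 z p; set Y := aff y0 y p in Y0 *.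
    move=> Q1 Q2; apply/eqP.
    have CE : C = (Z ^+ 2 - Y) / Y ^+ 2.
      apply: (mulIf (x := Y ^+ 2)); first by rewrite expf_neq0.
      by rewrite divfK ?expf_neq0 //; lra.
    have fE : f = - (a * Z ^+ 2 + b * Z * Y + c * Y ^+ 2 + d * Z + e * Y) by lra.
    by rewrite CE fE; field.
  move=> /(leq_ltn_trans ss) /leq_trans /(_ (size_Poly _)).
  by rewrite /= ltnn.
have cf i : nth 0 [:: c - e * C + f * C ^+ 2; b - d * C; a + e - 2 * f * C; d; f] i = 0.
  by rewrite -coef_Poly -/P P0 coef0.
(* The vanishing of all coefficients makes the second equation [a] times the first. *)
have := cf 0; have := cf 1; have := cf 2; have := cf 3; have := cf 4 => /=.
move=> f0 d0; rewrite f0 d0 => e0 b0 c0 p; rewrite E f0 d0 /conic => Q.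
have bE : b = 0 by lra.
have eE : e = - a by lra.
have cE : c = - a * C by move: c0; rewrite eE; lra.
rewrite bE eE cE.
transitivity (a * (aff z0 z p ^+ 2 - aff y0 y p - C * aff y0 y p ^+ 2)).
  by ring.
by rewrite Q mulr0.
Qed.

(** The leading coefficient depends on the direction only: it is zero in an asymptotic direction and
    nonnegative once [C < 0]. *)
Lemma conic_ray (z0 y0 C : R) z y p v l : conic z0 y0 C z y (ray p v l) =
  conic z0 y0 C z y p
  + l * (2 * aff z0 z p * dot z v - dot y v - 2 * C * aff y0 y p * dot y v)
  + l ^+ 2 * (dot z v ^+ 2 - C * dot y v ^+ 2).
Proof. by rewrite /conic !aff_ray; ring. Qed.

Lemma opp_ray p v l : ray p (- v.1, - v.2) l = ray p v (- l).
Proof. by rewrite /ray /= !mulrN !mulNr. Qed.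

Lemma exit_line K p v : compact K -> K° p -> v <> (0, 0) ->
  exists l m, [/\ 0 < l, m < 0, bdry K (ray p v l) & bdry K (ray p v m)].
Proof.
move=> Kc Kp v0; have [l l0 Hl] := exit_ray Kc Kp v0.
have [|m m0 Hm] := @exit_ray R K p (- v.1, - v.2) Kc Kp.
  move=> [] /eqP; rewrite oppr_eq0 => /eqP v1 /eqP.
  by rewrite oppr_eq0 => /eqP v2; apply: v0; move: v1 v2; case: (v) => ? ? /= -> ->.
exists l, (- m); rewrite -opp_ray; split => //; lra.
Qed.

Lemma dot_neq0 z v : dot z v != 0 -> v <> (0, 0).
Proof. by move=> /eqP zv v0; apply: zv; rewrite v0 /dot /= !mulr0 addr0. Qed.

(** * Compact bodies bounded by a conic *)

Section Body.
Variables (K : set (pt R)) (z0 y0 C : R) (z y : pt R).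
Hypotheses (Kc : compact K) (K0 : exists p, K° p) (D0 : cross z y != 0).
Hypothesis bK : forall p, bdry K p -> conic z0 y0 C z y p = 0.

(* A line in an asymptotic direction meets the conic at most once. *)
Lemma conic_body_elliptic : C < 0.
Proof.
rewrite ltNge; apply/negP => C0.
pose r := Num.sqrt C; have r2 : r ^+ 2 = C by rewrite sqr_sqrtr.
(* In this asymptotic direction the equation is affine along the line; two distinct zeros force its
   slope to vanish, which is [Hi]. *)
have [v [zv yv]] := @dual_vector y z r 1 D0.
have Hi p : K° p -> 2 * aff z0 z p * r - 1 - 2 * C * aff y0 y p = 0.
  move=> Kp.
  have v0 : v <> (0, 0) by apply: (@dot_neq0 y); rewrite yv oner_eq0.
  have [l [m [l0 m0 /bK + /bK]]] := @exit_line K p v Kc Kp v0.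
  rewrite !conic_ray zv yv r2 !mulr1 expr1n mulr1 subrr !mulr0 !addr0.
  set Q := conic _ _ _ _ _ _; set A := _ - _ => H1 H2.
  have : (l - m) * A = 0 by lra.
  by move/eqP; rewrite mulf_eq0 => /orP[/eqP|/eqP//]; lra.
(* Comparing [Hi] at two interior points that differ along [w] gives [r = 0], hence [C = 0], and
   [Hi] then reads [-1 = 0]. *)
have [p Kp] := K0.
have [w [zw yw]] := @dual_vector y z 1 0 D0.
have [l l0 Kl] := @interior_ray R K p w Kp.
have := Hi _ Kp; have := Hi _ Kl; rewrite !aff_ray zw yw => H1 H2.
have : 2 * l * r = 0 by lra.
move/eqP; rewrite !mulf_eq0 => /orP[/orP[|]|] /eqP; [lra|lra|].
by move=> r0; move: H2; rewrite -r2 r0; lra.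
Qed.

(** Along [w] the equation is a monic quadratic with one positive root [l] and one negative root
    [m]; by Vieta its value at [p] is [l * m]. *)
Lemma conic_interior p : K° p -> conic z0 y0 C z y p < 0.
Proof.
move=> Kp.
have [w [zw yw]] := @dual_vector y z 1 0 D0.
have w0 : w <> (0, 0) by apply: (@dot_neq0 z); rewrite zw oner_eq0.
have [l [m [l0 m0 /bK + /bK]]] := @exit_line K p w Kc Kp w0.
rewrite !conic_ray zw yw; set Q := conic _ _ _ _ _ _; set A := _ - _ => H1 H2.
have : (l - m) * (Q - l * m) = 0.
  have -> : (l - m) * (Q - l * m) = l * (Q + m * A + m ^+ 2 * (1 ^+ 2 - C * 0 ^+ 2)) -
    m * (Q + l * A + l ^+ 2 * (1 ^+ 2 - C * 0 ^+ 2)) by ring.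
  by rewrite H1 H2; ring.
move/eqP; rewrite mulf_eq0 => /orP[/eqP|/eqP]; first lra.
have : l * m < 0 by rewrite pmulr_rlt0.
by lra.
Qed.

(** For the reverse inclusion, join an interior point to a point outside [K] with value at most 0.
    Since [C < 0] the equation is convex along the segment, so it is negative before the far end,
    where a boundary point would have to be a zero. *)
Lemma conic_body : K = [set p | conic z0 y0 C z y p <= 0].
Proof.
have clK : closed K by apply: compact_closed => //; exact: norm_hausdorff.
apply/seteqP; split => [p Kp|p /= Qp].
  case: (pselect (K° p)) => [/conic_interior/ltW//|Kp'].
  by rewrite /= bK //; split => //; exact: subset_closure.
apply: contrapT => Kp; have [q Kq] := K0.
have E : ray q (psub p q) 1 = p.
  by case: (p) (q) => a b [c d]; rewrite /ray /psub /= !mul1r !subrKC.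
have [|l l01 /bK] := @exit_segment R K q (psub p q) clK (interior_subset Kq).
  by rewrite E.
have := Qp; rewrite -{1}E !conic_ray; have := conic_interior Kq.
have := conic_body_elliptic.
set Q := conic _ _ _ _ _ _; set A := _ - _; set a := dot z _; set b := dot y _.
move=> C0 Q0 H1 H2.
have B0 : 0 <= a ^+ 2 - C * b ^+ 2.
  by rewrite addr_ge0 ?sqr_ge0 // -mulNr mulr_ge0 ?sqr_ge0 //; lra.
move: B0 H1 H2; set B := a ^+ 2 - _ => B0 H1 H2.
have [l0 l1] := andP l01.
have := mulr_ge0_le0 l0 H1.
have : (1 - l) * Q < 0 by rewrite pmulr_rlt0 //; lra.
have : 0 <= l * (1 - l) * B by rewrite !mulr_ge0 //; lra.
by lra.
Qed.

Lemma conic_body_ellipse : is_ellipse K.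
Proof.
have C0 := conic_body_elliptic.
pose k := - C; have k0 : 0 < k by rewrite /k; lra.
(* [v] is the centre: completing the square gives [Z^2 + k (Y - 1/(2k))^2 - 1/(4k)], and
   multiplication by [4k] produces [a], [b], [c]. *)
have [v [zv yv]] := @dual_vector y z (- z0) ((2 * k)^-1 - y0) D0.
pose a := 4 * k * z.1 ^+ 2 + 4 * k ^+ 2 * y.1 ^+ 2.
pose b := 4 * k * z.1 * z.2 + 4 * k ^+ 2 * y.1 * y.2.
pose c := 4 * k * z.2 ^+ 2 + 4 * k ^+ 2 * y.2 ^+ 2.
have E p : conic z0 y0 C z y p = (4 * k)^-1 * (a * (p.1 - v.1) ^+ 2
    + 2 * b * (p.1 - v.1) * (p.2 - v.2) + c * (p.2 - v.2) ^+ 2 - 1).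
  have -> : z0 = - dot z v by lra.
  have -> : y0 = (2 * k)^-1 - dot y v by lra.
  have -> : C = - k by rewrite /k; lra.
  by rewrite /conic /aff /dot /a /b /c; field; lra.
exists v.1, v.2, a, b, c.
split.
  rewrite /a lt_neqAle eq_sym; apply/andP; split.
    apply: contraNN D0 => /eqP H.
    have z1 : z.1 = 0.
      apply/eqP; rewrite -sqrf_eq0; apply/eqP.
      have := sqr_ge0 z.1; have := sqr_ge0 y.1; nra.
    have y1 : y.1 = 0.
      apply/eqP; rewrite -sqrf_eq0; apply/eqP.
      have := sqr_ge0 y.1; have := exprn_gt0 2 k0; rewrite z1 in H; nra.
    by rewrite /cross z1 y1 !(mul0r, mulr0) subrr.
  by rewrite addr_ge0 // mulr_ge0 ?sqr_ge0 // mulr_ge0 ?sqr_ge0 // ltW.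
split.
  rewrite [X in 0 < X](_ : _ = 16 * k ^+ 3 * cross z y ^+ 2).
    have D2 : 0 < cross z y ^+ 2 by rewrite exprn_even_gt0.
    by apply: mulr_gt0 => //; apply: mulr_gt0; [lra|exact: exprn_gt0].
  by rewrite /a /b /c /cross; ring.
rewrite [LHS]conic_body; apply/seteqP.
by split => p /=; rewrite E pmulr_rle0 ?subr_le0 // invr_gt0; lra.
Qed.
End Body.
End Conics.

(** * Derivatives, mean values and the differential equation of a conic *)

Section Deriv.
Set Implicit Arguments.
Unset Strict Implicit.
Variable R : realType.
Implicit Types (f g : R -> R) (x a b k : R).

(** The rules of calculus are stated for explicit functions, so that derivatives of compound
    expressions can be written as proof terms. *)
Lemma derive_add f g x a b : is_derive x 1 f a -> is_derive x 1 g b ->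
  is_derive x 1 (fun x => f x + g x) (a + b).
Proof. by move=> df dg; exact: is_deriveD. Qed.

Lemma derive_sub f g x a b : is_derive x 1 f a -> is_derive x 1 g b ->
  is_derive x 1 (fun x => f x - g x) (a - b).
Proof. by move=> df dg; exact: is_deriveB. Qed.

Lemma derive_mul f g x a b : is_derive x 1 f a -> is_derive x 1 g b ->
  is_derive x 1 (fun x => f x * g x) (f x * b + g x * a).
Proof. by move=> df dg; exact: is_deriveM. Qed.

Lemma derive_const k x : is_derive x 1 (fun _ => k) 0.
Proof. exact: is_derive_cst. Qed.

Lemma derive_div f g x a b : g x != 0 ->
  is_derive x 1 f a -> is_derive x 1 g b ->
  is_derive x 1 (fun x => f x / g x) ((a * g x - f x * b) / g x ^+ 2).
Proof.
move=> g0 df dg.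
have dV := is_deriveV g0 dg.
have := @derive_mul f (fun x => (g x)^-1) x a _ df dV.
set u := (X in is_derive _ _ _ X); set v := (X in _ -> is_derive _ _ _ X).
suff -> : u = v by [].
by rewrite /u /v /GRing.scale /=; field.
Qed.

Lemma mean_value_ball f (df : R -> R) (c e : R) :
  (forall x, `|x - c| < e -> is_derive x 1 f (df x)) ->
  forall a b, `|a - c| < e -> `|b - c| < e ->
  exists2 x, `|x - c| < e & f b - f a = df x * (b - a).
Proof.
move=> Hf; have H a b : a <= b -> `|a - c| < e -> `|b - c| < e ->
    exists2 x, `|x - c| < e & f b - f a = df x * (b - a).
  move=> ab; rewrite !ltr_norml => Ha Hb.
  have Hin x : x \in `[a, b]%R -> `|x - c| < e.
    by rewrite in_itv /= ltr_norml => xab; lra.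
  have Hoo x : x \in `]a, b[%R -> is_derive x 1 f (df x).
    by move=> xab; apply: Hf; apply: Hin; exact: subset_itv_oo_cc.
  have Hc : {within `[a, b], continuous f}.
    by apply: derivable_within_continuous => x /Hin /Hf [].
  by have [x xab E] := MVT_segment ab Hoo Hc; exists x => //; exact: Hin.
move=> a b Ha Hb; case: (leP a b) => [ab|/ltW ba]; first exact: H.
have [x Hx E] := H b a ba Hb Ha; exists x => //; lra.
Qed.

Lemma derive_near0 f x a (e : R) : 0 < e ->
  (forall y, `|y - x| < e -> f y = 0) -> is_derive x 1 f a -> a = 0.
Proof.
move=> e0 f0 df.
suff : is_derive x 1 f 0.
  by move=> df0; rewrite -(@derive_val _ _ _ _ _ _ _ df) (@derive_val _ _ _ _ _ _ _ df0).
apply: (near_eq_is_derive _ (derive_const 0 x)).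
apply/nbhs_ballP; exists e => //= y; rewrite /ball /= distrC => Hy.
by rewrite f0.
Qed.

(** Up to the factor [y], the numerator of the derivative of [(z^2 - y) / y^2] is the difference of
    the two sides of the equation, so this quotient is a constant [C]. The slope [z / y] has a
    nonvanishing derivative, whence its injectivity by the mean value theorem. *)
Lemma conic_ode (z y dz dy : R -> R) (c e : R) : 0 < e ->
  (forall x, `|x - c| < e -> [/\ is_derive x 1 z (dz x), is_derive x 1 y (dy x),
    y x != 0, z x * dy x - dz x * y x != 0 &
    y x * dy x = 2 * z x * (z x * dy x - dz x * y x)]) ->
  exists C : R, (forall x, `|x - c| < e -> z x ^+ 2 - y x - C * y x ^+ 2 = 0) /\
  (forall a b, `|a - c| < e -> `|b - c| < e -> z a / y a = z b / y b -> a = b).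
Proof.
move=> e0 H; have c0 : `|c - c| < e by rewrite subrr normr0.
pose h x := (z x * z x - y x) / (y x * y x).
exists (h c); split.
  have dh x : `|x - c| < e -> is_derive x 1 h 0.
    move=> /H[d1 d2 y0 _ E].
    have yy0 : y x * y x != 0 by rewrite mulf_neq0.
    have dh : is_derive x 1 h _ :=
      derive_div (g := fun x => y x * y x) yy0
        (derive_sub (derive_mul d1 d1) d2) (derive_mul d2 d2).
    apply: (is_derive_eq dh); apply/eqP; rewrite mulf_eq0; apply/orP; left.
    apply/eqP; transitivity (y x * (y x * dy x - 2 * z x * (z x * dy x - dz x * y x))).
      by ring.
    by rewrite -E subrr mulr0.
  move=> x Hx; have [_ _ y0 _ _] := H x Hx.
  have [w _] := mean_value_ball (df := fun=> 0) dh c0 Hx.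
  rewrite mul0r => /eqP; rewrite subr_eq0 => /eqP <-.
  by rewrite /h; field.
move=> a b Ha Hb E.
pose u x := z x / y x.
pose du x := (dz x * y x - z x * dy x) / y x ^+ 2.
have dU x : `|x - c| < e -> is_derive x 1 u (du x).
  by move=> /H[d1 d2 y0 _ _]; exact: derive_div.
have [w Hw] := mean_value_ball dU Ha Hb.
rewrite /u E subrr => /esym/eqP; rewrite mulf_eq0 subr_eq0 => /orP[|/eqP//].
have [_ _ y0 W _] := H w Hw.
rewrite mulf_eq0 invr_eq0 sqrf_eq0 (negPf y0) orbF subr_eq0 eq_sym -subr_eq0.
by rewrite (negPf W).
Qed.
End Deriv.

(** * Differentiating the chord identity along the curve *)

Section Arc.
Set Implicit Arguments.
Unset Strict Implicit.
Variable R : realType.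

(** Multiplying by the central value treats both signs at once. *)
Lemma same_sign_near (F : R * R -> R) (s0 t0 : R) :
  continuous F -> F (s0, t0) != 0 ->
  exists2 e : R, 0 < e & forall s t, `|s - s0| < e -> `|t - t0| < e ->
    0 < F (s, t) * F (s0, t0).
Proof.
move=> Fc F0.
have : \forall w \near (s0, t0), 0 < F w * F (s0, t0).
  have : F w * F (s0, t0) @[w --> (s0, t0)] --> F (s0, t0) * F (s0, t0).
    by apply: cvgM; [exact: Fc|exact: cvg_cst].
  move=> /cvgr_gt; apply.
  by rewrite -expr2 exprn_even_gt0.
move=> /nbhs_ballP[e /= e0 He]; exists e => // s t Hs Ht.
by apply: (He (s, t)); split; rewrite /ball /= distrC.
Qed.

Lemma derivable_continuous (f : R -> R) :
  (forall x, derivable f x 1) -> continuous f.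
Proof. by move=> df x; apply/differentiable_continuous/derivable1_diffP. Qed.

Lemma continuous_fst (f : R -> R) : continuous f ->
  continuous (fun w : R * R => f w.1).
Proof.
move=> fc w.
apply: (cvg_comp _ _ (cvg_fst (F := nbhs w.1) (G := nbhs w.2))) => //.
exact: fc.
Qed.

Lemma continuous_snd (f : R -> R) : continuous f ->
  continuous (fun w : R * R => f w.2).
Proof.
move=> fc w.
apply: (cvg_comp _ _ (cvg_snd (F := nbhs w.1) (G := nbhs w.2))) => //.
exact: fc.
Qed.

Lemma norm_cube_inj (x y : R) : 0 < x * y -> `|x| ^+ 3 = `|y| ^+ 3 -> x = y.
Proof.
move=> xy /eqP; rewrite eqrXn2 // eqr_norm2 => /orP[/eqP//|/eqP xE].
by move: xy; rewrite xE mulNr -expr2 oppr_gt0 ltNge sqr_ge0.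
Qed.

(** The entries [a], [a1], [a2], [a0] belong to the parameter pairs [(s, t)], [(s, t0)], [(s0, t)],
    [(s0, t0)], and likewise for [b]. The factors [d] and [e], built from second derivatives and
    hence only continuous on a curve of class C2, cancel before anything is differentiated; the sign
    conditions allow cube roots without absolute values. *)
Lemma cube_ratio_rank_one (a a1 a2 a0 b b1 b2 b0 d1 d2 e1 e2 : R) :
  0 < d1 -> 0 < d2 -> 0 < e1 -> 0 < e2 ->
  0 < a * a0 -> 0 < a1 * a0 -> 0 < a2 * a0 ->
  0 < b * b0 -> 0 < b1 * b0 -> 0 < b2 * b0 ->
  `|a| ^+ 3 * e1 = `|b| ^+ 3 * d1 ->
  `|a1| ^+ 3 * e2 = `|b1| ^+ 3 * d1 ->
  `|a2| ^+ 3 * e1 = `|b2| ^+ 3 * d2 ->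
  `|a0| ^+ 3 * e2 = `|b0| ^+ 3 * d2 ->
  a * b1 * (a0 * b2) = a1 * b * (a2 * b0).
Proof.
move=> d1p d2p e1p e2p sa sa1 sa2 sb sb1 sb2 E E1 E2 E0.
apply: norm_cube_inj.
  have a0n : 0 < (a0 * b0) ^+ 2.
    rewrite exprn_even_gt0 //=; apply: contraTneq sa => /eqP.
    rewrite mulf_eq0 => /orP[|] /eqP a00; first by rewrite a00 mulr0 ltxx.
    by move: sb; rewrite a00 mulr0 ltxx.
  rewrite -(pmulr_lgt0 _ a0n).
  rewrite [X in 0 < X](_ : _ = (a * a0) * (a1 * a0) * (a2 * a0) *
    ((b * b0) * (b1 * b0) * (b2 * b0))); last by ring.
  by apply: mulr_gt0; apply: mulr_gt0 => //; apply: mulr_gt0.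
rewrite !normrM !exprMn.
have h : 0 < e1 * e2 * d1 * d2 by rewrite !mulr_gt0.
apply: (mulIf (x := e1 * e2 * d1 * d2)); first by rewrite gt_eqF.
transitivity ((`|a| ^+ 3 * e1) * (`|b1| ^+ 3 * d1) *
  ((`|a0| ^+ 3 * e2) * (`|b2| ^+ 3 * d2))).
  by ring.
rewrite E -E1 E0 -E2; by ring.
Qed.

Lemma crossC (u v : pt R) : cross u v = - cross v u.
Proof. by rewrite /cross; ring. Qed.

Variables g1 g2 : R -> R.
Hypotheses (C1 : C2fun g1) (C2 : C2fun g2).
Local Notation c := (curve g1 g2).
Local Notation T := (tangent g1 g2).
Local Notation N := (accel g1 g2).

Lemma is_derive_g1 (x : R) : is_derive x 1 g1 (T x).1.
Proof. by rewrite /= derive1E; apply: derivableP; exact: C1.1. Qed.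
Lemma is_derive_g2 (x : R) : is_derive x 1 g2 (T x).2.
Proof. by rewrite /= derive1E; apply: derivableP; exact: C2.1. Qed.
Lemma is_derive_T1 (x : R) : is_derive x 1 (fun x => (T x).1) (N x).1.
Proof.
by rewrite /= [X in is_derive _ _ _ X]derive1E; apply: derivableP; exact: C1.2.1.
Qed.
Lemma is_derive_T2 (x : R) : is_derive x 1 (fun x => (T x).2) (N x).2.
Proof.
by rewrite /= [X in is_derive _ _ _ X]derive1E; apply: derivableP; exact: C2.2.1.
Qed.

(** [crossl] and [crossr] are, up to sign, the sines of the angles at the two ends times the lengths
    of tangent and chord; [crossr s t] equals [crossl t s]. *)
Definition crossl s t := cross (T s) (psub (c t) (c s)).
Definition crossr s t := cross (psub (c t) (c s)) (T t).

(** Moving [s] changes the chord vector by [- T s], which is parallel to [T s]; only the term with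
    [N s] survives. *)
Lemma is_derive_crossl (s t : R) :
  is_derive s 1 (crossl ^~ t) (cross (N s) (psub (c t) (c s))).
Proof.
rewrite /crossl /cross /psub /=.
apply: is_derive_eq.
  exact: (derive_sub
    (derive_mul (is_derive_T1 s) (derive_sub (derive_const _ s) (is_derive_g2 s)))
    (derive_mul (is_derive_T2 s) (derive_sub (derive_const _ s) (is_derive_g1 s)))).
rewrite /=; move: (derive1 (derive1 g1) s) (derive1 (derive1 g2) s).
move: (derive1 g1 s) (derive1 g2 s) (g1 s) (g2 s) (g1 t) (g2 t) => *.
by ring.
Qed.

Lemma is_derive_crossr (s t : R) :
  is_derive s 1 (crossr ^~ t) (- cross (T s) (T t)).
Proof.
rewrite /crossr /cross /psub /=.
apply: is_derive_eq.
  exact: (derive_sub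
    (derive_mul (derive_sub (derive_const _ s) (is_derive_g1 s)) (derive_const _ s))
    (derive_mul (derive_sub (derive_const _ s) (is_derive_g2 s)) (derive_const _ s))).
rewrite /=; move: (derive1 g1 s) (derive1 g2 s) (derive1 g1 t) (derive1 g2 t).
move: (g1 s) (g2 s) (g1 t) (g2 t) => *.
by ring.
Qed.

Lemma is_derive_aff (a : R) (z : pt R) (t : R) :
  is_derive t 1 (fun t => aff a z (c t)) (dot z (T t)).
Proof.
rewrite /aff /dot /=.
apply: is_derive_eq.
  exact: (derive_add (derive_const _ t) (derive_add
    (derive_mul (derive_const _ t) (is_derive_g1 t))
    (derive_mul (derive_const _ t) (is_derive_g2 t)))).
rewrite /=; move: (derive1 g1 t) (derive1 g2 t) (g1 t) (g2 t) => *.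
by ring.
Qed.

Lemma continuous_g1 : continuous g1.
Proof. exact: derivable_continuous C1.1. Qed.
Lemma continuous_g2 : continuous g2.
Proof. exact: derivable_continuous C2.1. Qed.
Lemma continuous_T1 : continuous (fun x => (T x).1).
Proof. exact: derivable_continuous C1.2.1. Qed.
Lemma continuous_T2 : continuous (fun x => (T x).2).
Proof. exact: derivable_continuous C2.2.1. Qed.

Lemma continuous_crossl : continuous (fun w : R * R => crossl w.1 w.2).
Proof.
move=> w; apply: cvgB; apply: cvgM.
- exact: continuous_fst continuous_T1 w.
- apply: cvgB; first exact: continuous_snd continuous_g2 w.
  exact: continuous_fst continuous_g2 w.
- exact: continuous_fst continuous_T2 w.
- apply: cvgB; first exact: continuous_snd continuous_g1 w.
  exact: continuous_fst continuous_g1 w.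
Qed.

Lemma continuous_crossr : continuous (fun w : R * R => crossr w.1 w.2).
Proof.
move=> w; apply: cvgB; apply: cvgM.
- apply: cvgB; first exact: continuous_snd continuous_g1 w.
  exact: continuous_fst continuous_g1 w.
- exact: continuous_snd continuous_T2 w.
- apply: cvgB; first exact: continuous_snd continuous_g2 w.
  exact: continuous_fst continuous_g2 w.
- exact: continuous_snd continuous_T1 w.
Qed.



Definition chord_identity s t := [/\ cross (T s) (N s) != 0,
  cross (T t) (N t) != 0 & `|crossl s t| ^+ 3 * `|cross (T t) (N t)| =
  `|crossr s t| ^+ 3 * `|cross (T s) (N s)|].

Lemma crossr_neq0 s t : chord_identity s t -> crossl s t != 0 ->
  crossr s t != 0.
Proof.
move=> [_ t0 E]; apply: contraNneq => r0; move: E; rewrite r0 normr0 expr0n mul0r.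
move/eqP; rewrite mulf_eq0 normr_eq0 (negPf t0) orbF.
by rewrite expf_eq0 normr_eq0.
Qed.

(* The ratio [crossl s t / crossr s t] splits as a product of a function of [s]
   and a function of [t]; differentiating this at [s0] gives the equation. *)
Lemma chord_equation s0 t0 (e : R) : 0 < e ->
  (forall s t, `|s - s0| < e -> `|t - t0| < e -> chord_identity s t) ->
  crossl s0 t0 != 0 ->
  exists2 e' : R, 0 < e' & exists k : R, forall t, `|t - t0| < e' ->
   [/\ crossl s0 t != 0, crossr s0 t != 0 &
    crossl s0 t * cross (T s0) (T t) = crossr s0 t *
     (cross (psub (c t) (c s0)) (N s0) + k * crossl s0 t)].
Proof.
move=> e0 He A0.
have B0 : crossr s0 t0 != 0 by apply: crossr_neq0 A0; apply: He; rewrite subrr normr0.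
have [ea ea0 Ha] := same_sign_near (F := fun w => crossl w.1 w.2) continuous_crossl A0.
have [eb eb0 Hb] := same_sign_near (F := fun w => crossr w.1 w.2) continuous_crossr B0.
rewrite /= in Ha Hb.
pose e' := Num.min e (Num.min ea eb).
have e'0 : 0 < e' by rewrite !lt_min e0 ea0.
have He' (x y : R) : `|x - y| < e' -> [/\ `|x - y| < e, `|x - y| < ea & `|x - y| < eb].
  by rewrite !lt_min => /and3P[].
exists e' => //.
pose A0' := cross (N s0) (psub (c t0) (c s0)).
pose B0' := - cross (T s0) (T t0).
(* The logarithmic derivative of [crossl / crossr] in [s] at [s0] is independent of [t]; this is its
   value at [t0]. *)
exists (A0' / crossl s0 t0 - B0' / crossr s0 t0) => t Ht.
have z0 : `|s0 - s0| < e' by rewrite subrr normr0.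
have z1 : `|t0 - t0| < e' by rewrite subrr normr0.
have [t1 t2 t3] := He' _ _ Ht; have [s1 s2 s3] := He' _ _ z0.
have [r1 r2 r3] := He' _ _ z1.
have An : crossl s0 t != 0.
  by apply: contraTneq (Ha _ _ s2 t2) => ->; rewrite mul0r ltxx.
have Bn : crossr s0 t != 0.
  by apply: contraTneq (Hb _ _ s3 t3) => ->; rewrite mul0r ltxx.
split => //.
(* Splitting of the ratio into a product, cross-multiplied so that [F] is differentiable without any
   division. *)
pose F s := crossl s t * crossr s t0 * (crossl s0 t0 * crossr s0 t)
  - crossl s t0 * crossr s t * (crossl s0 t * crossr s0 t0).
have F0 s : `|s - s0| < e' -> F s = 0.
  move=> Hs; have [u1 u2 u3] := He' _ _ Hs.
  apply/eqP; rewrite subr_eq0; apply/eqP.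
  have [ds dt E] := He _ _ u1 t1; have [_ dt0 E1] := He _ _ u1 r1.
  have [ds0 _ E2] := He _ _ s1 t1; have [_ _ E0] := He _ _ s1 r1.
  rewrite -normr_gt0 in ds; rewrite -normr_gt0 in dt.
  rewrite -normr_gt0 in ds0; rewrite -normr_gt0 in dt0.
  exact: (cube_ratio_rank_one ds ds0 dt dt0 (Ha _ _ u2 t2) (Ha _ _ u2 r2)
    (Ha _ _ s2 t2) (Hb _ _ u3 t3) (Hb _ _ u3 r3) (Hb _ _ s3 t3) E E1 E2 E0).
have dF : is_derive s0 1 F _ := derive_sub
  (derive_mul (derive_mul (is_derive_crossl s0 t) (is_derive_crossr s0 t0))
    (derive_const _ s0))
  (derive_mul (derive_mul (is_derive_crossl s0 t0) (is_derive_crossr s0 t))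
    (derive_const _ s0)).
have := derive_near0 e'0 F0 dF.
rewrite -/A0' -/B0'.
have -> : cross (N s0) (psub (c t) (c s0)) = - cross (psub (c t) (c s0)) (N s0).
  exact: crossC.
set A := crossl s0 t in An *; set B := crossr s0 t in Bn *.
move: A0 B0; set A0 := crossl s0 t0; set B0 := crossr s0 t0 => A0n B0n H.
(* With the denominators of [k] cleared, the difference of the two sides is the derivative of [F] at
   [s0]. *)
apply: (mulIf (x := A0 * B0)); first by rewrite mulf_neq0.
apply/eqP; rewrite -subr_eq0; apply/eqP.
rewrite -[RHS]H; field.
by rewrite A0n B0n.
Qed.

End Arc.

(** * Arcs of the boundary lie on conics *)

Section LocalConic.
Set Implicit Arguments.
Unset Strict Implicit.
Variables (R : realType) (g1 g2 : R -> R).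
Hypotheses (C1 : C2fun g1) (C2 : C2fun g2).
Local Notation c := (curve g1 g2).
Local Notation T := (tangent g1 g2).
Local Notation N := (accel g1 g2).

(** The last two clauses serve [conic_unique]: distinct parameters give distinct slopes, with
    nonzero denominators. *)
Definition arc_on_conic (t0 e z0 y0 C : R) (z y : pt R) :=
  [/\ 0 < e, cross z y != 0,
    forall t, `|t - t0| < e ->
      aff y0 y (c t) != 0 /\ conic z0 y0 C z y (c t) = 0 &
    forall a b, `|a - t0| < e -> `|b - t0| < e ->
      aff z0 z (c a) / aff y0 y (c a) = aff z0 z (c b) / aff y0 y (c b) -> a = b].

(** The factor [2 * d] in [y] absorbs the coefficient of the linear term, so that the conic takes
    the normal form of [conic]. *)
Lemma frame_identities (k : R) (e1 e2 p0 p v : pt R) :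
  let d := cross e1 e2 in
  let z : pt R := (e2.2 - k * e1.2, k * e1.1 - e2.1) in
  let y : pt R := (- (2 * d * e1.2), 2 * d * e1.1) in
  let Z := cross (psub p p0) e2 + k * cross e1 (psub p p0) in
  [/\ cross z y = 2 * d ^+ 2, aff (- dot z p0) z p = Z,
    aff (- dot y p0) y p = 2 * d * cross e1 (psub p p0),
    dot y v = 2 * d * cross e1 v &
    Z * dot y v - dot z v * (2 * d * cross e1 (psub p p0)) =
      2 * d ^+ 2 * cross (psub p p0) v].
Proof.
by rewrite /aff /dot /cross /psub /=; split; ring.
Qed.

Lemma local_conic s0 t0 (e : R) : 0 < e ->
  (forall s t, `|s - s0| < e -> `|t - t0| < e -> chord_identity g1 g2 s t) ->
  crossl g1 g2 s0 t0 != 0 ->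
  exists e' z0 y0 C z y, arc_on_conic t0 e' z0 y0 C z y.
Proof.
move=> e0 He A0.
have d0 : cross (T s0) (N s0) != 0.
  by have [] := He s0 t0; rewrite ?subrr ?normr0.
have [e' e'0 [k Hk]] := chord_equation C1 C2 e0 He A0.
pose d := cross (T s0) (N s0).
pose z : pt R := ((N s0).2 - k * (T s0).2, k * (T s0).1 - (N s0).1).
pose y : pt R := (- (2 * d * (T s0).2), 2 * d * (T s0).1).
pose z0 := - dot z (c s0); pose y0 := - dot y (c s0).
have H x : `|x - t0| < e' ->
   [/\ is_derive x 1 (fun x => aff z0 z (c x)) (dot z (T x)),
     is_derive x 1 (fun x => aff y0 y (c x)) (dot y (T x)), aff y0 y (c x) != 0,
     aff z0 z (c x) * dot y (T x) - dot z (T x) * aff y0 y (c x) != 0 &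
     aff y0 y (c x) * dot y (T x) = 2 * aff z0 z (c x) *
       (aff z0 z (c x) * dot y (T x) - dot z (T x) * aff y0 y (c x))].
  move=> /Hk[l0 r0 E].
  have [_ Ez Ey Ev EW] := frame_identities k (T s0) (N s0) (c s0) (c x) (T x).
  rewrite -/d -/z -/y -/z0 -/y0 in Ez Ey Ev EW.
  rewrite /crossl /crossr in l0 r0 E.
  have -> : aff z0 z (c x) * dot y (T x) - dot z (T x) * aff y0 y (c x) =
    2 * d ^+ 2 * cross (psub (c x) (c s0)) (T x) by rewrite Ez Ey.
  split.
  - exact: is_derive_aff.
  - exact: is_derive_aff.
  - by rewrite Ey !mulf_neq0 // pnatr_eq0.
  - by rewrite !mulf_neq0 ?expf_neq0 // pnatr_eq0.
  (* In this notation [E] reads [l * m = r * Z]; multiplied by [4 d^2] it is the equation required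
     by [conic_ode]. *)
  - rewrite Ez Ey Ev; move: E; set Z := _ + _ ; set l := cross (T s0) (psub _ _).
    set r := cross (psub _ _) (T x); set m := cross (T s0) (T x) => E.
    transitivity (4 * d ^+ 2 * (l * m)); first by ring.
    by rewrite E; ring.
have [C [HC Hu]] := conic_ode e'0 H.
exists e', z0, y0, C, z, y; split => //.
  have [-> _ _ _ _] := frame_identities k (T s0) (N s0) (c s0) (c s0) (T s0).
  by rewrite mulf_neq0 ?expf_neq0 // pnatr_eq0.
by move=> t Ht; split; [have [] := H t Ht|exact: HC].
Qed.

Lemma cross_eq0_basis (u v p : pt R) :
  cross u v != 0 -> cross u p = 0 -> cross v p = 0 -> p = (0, 0).
Proof.
move=> d0 up vp; rewrite [p]surjective_pairing.
congr pair; apply: (mulfI d0); rewrite mulr0.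
  transitivity (v.1 * cross u p - u.1 * cross v p); first by rewrite /cross; ring.
  by rewrite up vp !mulr0 subrr.
transitivity (v.2 * cross u p - u.2 * cross v p); first by rewrite /cross; ring.
by rewrite up vp !mulr0 subrr.
Qed.

(* When the chord is tangent to the curve at [s0], the tangency is destroyed by
   moving [s0]: the derivative of [crossl] in [s] does not vanish there. *)
Lemma crossl_neq0_near s0 t0 (e : R) : 0 < e ->
  c s0 <> c t0 -> cross (T s0) (N s0) != 0 ->
  exists2 s, `|s - s0| < e & crossl g1 g2 s t0 != 0.
Proof.
move=> e0 st d0; apply: contrapT => H.
have l0 s : `|s - s0| < e -> crossl g1 g2 s t0 = 0.
  by move=> Hs; apply/eqP; apply: contrapT => /negP Hn; apply: H; exists s.
have := derive_near0 e0 l0 (is_derive_crossl C1 C2 s0 t0).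
have : crossl g1 g2 s0 t0 = 0 by apply: l0; rewrite subrr normr0.
move=> H1 H2; have [/eqP p1 /eqP p2] := cross_eq0_basis d0 H1 H2.
by apply: st; move: p1 p2; rewrite !subr_eq0 /curve => /eqP -> /eqP ->.
Qed.

End LocalConic.

(** * From angles and curvature to cross products *)

Section Angles.
Set Implicit Arguments.
Unset Strict Implicit.
Variable R : realType.
Implicit Types u v : pt R.

Lemma dot_ge0 u : 0 <= dot u u.
Proof. by rewrite /dot -!expr2 addr_ge0 ?sqr_ge0. Qed.

Lemma enorm_sqr u : enorm u ^+ 2 = dot u u.
Proof. by rewrite sqr_sqrtr ?dot_ge0. Qed.

Lemma dot_gt0 u : u <> (0, 0) -> 0 < dot u u.
Proof.
move=> u0; rewrite lt_neqAle dot_ge0 andbT eq_sym; apply/eqP => /eqP.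
rewrite /dot -!expr2 paddr_eq0 ?sqr_ge0 // !sqrf_eq0 => /andP[/eqP u1 /eqP u2].
by apply: u0; rewrite [u]surjective_pairing u1 u2.
Qed.

Lemma enorm_gt0 u : u <> (0, 0) -> 0 < enorm u.
Proof. by move=> /dot_gt0; rewrite sqrtr_gt0. Qed.

(** The sine of an arccosine, combined with Lagrange's identity [|u|^2 |v|^2 = (dot u v)^2 + (cross
    u v)^2]. *)
Lemma sin_line_angle u v : u <> (0, 0) -> v <> (0, 0) ->
  sin (line_angle u v) = `|cross u v| / (enorm u * enorm v).
Proof.
move=> /enorm_gt0 u0 /enorm_gt0 v0.
have n0 : 0 < enorm u * enorm v by rewrite mulr_gt0.
have E : (enorm u * enorm v) ^+ 2 = dot u v ^+ 2 + cross u v ^+ 2.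
  by rewrite exprMn !enorm_sqr /dot /cross; ring.
have le1 : `|dot u v| / (enorm u * enorm v) <= 1.
  rewrite ler_pdivrMr // mul1r -(ler_pXn2r (n := 2)) ?nnegrE ?normr_ge0 ?(ltW n0) //.
  by rewrite real_normK ?num_real // E lerDl sqr_ge0.
have ge0 : 0 <= `|dot u v| / (enorm u * enorm v).
  by rewrite divr_ge0 ?normr_ge0 ?ltW.
rewrite /line_angle sin_acos; last by rewrite le1 andbT; lra.
rewrite [X in Num.sqrt X](_ : _ = (`|cross u v| / (enorm u * enorm v)) ^+ 2).
  by rewrite sqrtr_sqr ger0_norm // divr_ge0 ?normr_ge0 ?ltW.
rewrite !expr_div_n !real_normK ?num_real // E.
have : dot u v ^+ 2 + cross u v ^+ 2 != 0 by rewrite -E expf_neq0 ?gt_eqF.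
by move=> ?; field.
Qed.

(** The speeds [ns] and [nt] cancel between sine and curvature at their own endpoints, and the chord
    length [nd] is common to both sides. *)
Lemma angle_identity (a b ks kt nd nt ns : R) : 0 < nd -> 0 < nt -> 0 < ns ->
  ks / ns ^+ 3 <> 0 -> kt / nt ^+ 3 <> 0 ->
  (a / (ns * nd)) ^+ 3 / (ks / ns ^+ 3) = (b / (nt * nd)) ^+ 3 / (kt / nt ^+ 3) ->
  [/\ ks != 0, kt != 0 & a ^+ 3 * kt = b ^+ 3 * ks].
Proof.
move=> nd0 nt0 ns0 /eqP.
rewrite mulf_eq0 negb_or => /andP[ks0 _] /eqP.
rewrite mulf_eq0 negb_or => /andP[kt0 _] E.
have ndn : nd != 0 by rewrite gt_eqF.
have ntn : nt != 0 by rewrite gt_eqF.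
have nsn : ns != 0 by rewrite gt_eqF.
split => //.
have -> : a ^+ 3 * kt = (a / (ns * nd)) ^+ 3 / (ks / ns ^+ 3) * (nd ^+ 3 * ks * kt).
  by field; rewrite nsn ks0 ndn.
by rewrite E; field; rewrite ntn kt0 ndn.
Qed.
End Angles.

(** * Gluing the local conics by connectedness *)

Section Global.
Set Implicit Arguments.
Unset Strict Implicit.
Variables (R : realType) (g1 g2 : R -> R).
Hypotheses (C1 : C2fun g1) (C2 : C2fun g2).
Local Notation c := (curve g1 g2).
Local Notation T := (tangent g1 g2).
Local Notation N := (accel g1 g2).
Hypothesis T0 : forall s, T s <> (0, 0).

Lemma psub_neq0 (p q : pt R) : p <> q -> psub p q <> (0, 0).
Proof.
move=> pq [] /eqP; rewrite subr_eq0 => /eqP p1 /eqP.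
rewrite subr_eq0 => /eqP p2; apply: pq.
by rewrite [p]surjective_pairing p1 p2 -surjective_pairing.
Qed.

Lemma chord_identity_of_angles s t : c s <> c t ->
  let d := psub (c t) (c s) in
  let alpha := line_angle (T s) d in
  let beta := line_angle (T t) d in
  curvature g1 g2 s <> 0 -> curvature g1 g2 t <> 0 ->
  sin alpha ^+ 3 / curvature g1 g2 s = sin beta ^+ 3 / curvature g1 g2 t ->
  chord_identity g1 g2 s t.
Proof.
move=> st d alpha beta.
have d0 : d <> (0, 0) by apply: psub_neq0 => /esym.
rewrite /alpha /beta /curvature (sin_line_angle (@T0 s) d0).
rewrite (sin_line_angle (@T0 t) d0).
move=> ks kt E.
have [k1 k2 {}E] := angle_identity (enorm_gt0 d0) (enorm_gt0 (@T0 t))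
  (enorm_gt0 (@T0 s)) ks kt E.
rewrite normr_eq0 in k1; rewrite normr_eq0 in k2.
have Er : `|crossr g1 g2 s t| = `|cross (T t) d| by rewrite /crossr crossC normrN.
by split; [exact: k1|exact: k2|rewrite Er; exact: E].
Qed.

(** A covering chord may have the given boundary point at either end; symmetry reduces both cases to
    one. *)
Lemma chord_identity_sym s t : chord_identity g1 g2 s t -> chord_identity g1 g2 t s.
Proof.
have E a b : crossl g1 g2 a b = crossr g1 g2 b a.
  rewrite /crossl /crossr /cross /psub /=.
  by move: (g1 a) (g2 a) (g1 b) (g2 b) (derive1 g1 a) (derive1 g2 a) => *; ring.
case=> ds dt H; split; [exact: dt|exact: ds|].
by rewrite (E t s) -(E s t); exact: esym H.
Qed.

Lemma curve_near t0 (e : R) : 0 < e -> exists2 e', 0 < e' &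
  forall t, `|t - t0| < e' -> enorm (psub (c t) (c t0)) < e.
Proof.
move=> e0.
have : \forall t \near t0, dot (psub (c t) (c t0)) (psub (c t) (c t0)) < e ^+ 2.
  have H : dot (psub (c t) (c t0)) (psub (c t) (c t0)) @[t --> t0] -->
      dot (psub (c t0) (c t0)) (psub (c t0) (c t0)).
    have F1 : g1 t - g1 t0 @[t --> t0] --> g1 t0 - g1 t0.
      exact: cvgB (continuous_g1 C1 (x := t0)) (cvg_cst _).
    have F2 : g2 t - g2 t0 @[t --> t0] --> g2 t0 - g2 t0.
      exact: cvgB (continuous_g2 C2 (x := t0)) (cvg_cst _).
    exact: cvgD (cvgM F1 F1) (cvgM F2 F2).
  move: H => /cvgr_lt; apply.
  by rewrite /dot /psub /= !subrr mulr0 addr0 exprn_gt0.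
move=> /nbhs_ballP[e' /= e'0 He']; exists e' => // t Ht.
rewrite -(ltr_pXn2r (n := 2)) ?nnegrE ?sqrtr_ge0 ?ltW // enorm_sqr.
by apply: He'; rewrite /ball /= distrC.
Qed.

Lemma curve_neq_near s0 t0 : c s0 <> c t0 -> exists2 e : R, 0 < e &
  forall s t, `|s - s0| < e -> `|t - t0| < e -> c s <> c t.
Proof.
move=> st0.
pose F (w : R * R) := dot (psub (c w.1) (c w.2)) (psub (c w.1) (c w.2)).
have Fc : continuous F.
  have F1 : continuous (fun w : R * R => g1 w.1 - g1 w.2).
    move=> w; apply: cvgB; first exact: (continuous_fst (continuous_g1 C1)).
    exact: (continuous_snd (continuous_g1 C1)).
  have F2 : continuous (fun w : R * R => g2 w.1 - g2 w.2).
    move=> w; apply: cvgB; first exact: (continuous_fst (continuous_g2 C2)).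
    exact: (continuous_snd (continuous_g2 C2)).
  by move=> w; exact: cvgD (cvgM (F1 w) (F1 w)) (cvgM (F2 w) (F2 w)).
have F0 : F (s0, t0) != 0 by rewrite gt_eqF // dot_gt0 //; exact: psub_neq0.
have [e e0 He] := same_sign_near Fc F0.
exists e => // s t Hs Ht E.
have := He s t Hs Ht; rewrite /F /= E /dot /psub /= !subrr mulr0 addr0 mul0r.
by rewrite ltxx.
Qed.

Lemma clopen_real (S : set R) : open S -> closed S -> S !=set0 -> S = setT.
Proof.
move=> So Sc S0; have : connected [set: R] by apply/connected_intervalP.
by apply => //; exists S => //; rewrite setTI.
Qed.

(** The parameters near which the curve stays on the conic found at 0 form an open set. It is closed
    because the local conic at a limit point shares a whole arc with that conic. *)
Lemma global_conic :
  (forall t0, exists e z0 y0 C z y, arc_on_conic g1 g2 t0 e z0 y0 C z y) ->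
  exists z0 y0 C z y, cross z y != 0 /\ forall t, conic z0 y0 C z y (c t) = 0.
Proof.
move=> H; have [e [z0 [y0 [C [z [y [e0 zy Hc _]]]]]]] := H 0.
exists z0, y0, C, z, y; split => //.
pose S := [set t | conic z0 y0 C z y (c t) = 0]°.
suff ST : S = setT.
  by move=> t; have /interior_subset : S t by rewrite ST.
apply: clopen_real; first exact: open_interior.
  move=> t St; have [e' [w0 [x0 [D [w [x [e'0 wx Hw Hu]]]]]]] := H t.
  have tb : nbhs t [set r | `|r - t| < e'].
    by apply/nbhs_ballP; exists e' => //= r; rewrite /ball /= distrC.
  have [t1 [St1 /= Ht1]] := St _ tb.
  have /nbhs_ballP[e1 /= e10 He1] := St1.
  have [r [r0 re1 re']] : exists r : R, [/\ 0 < r, r <= e1 & r <= e' - `|t1 - t|].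
    exists (Num.min e1 (e' - `|t1 - t|)).
    by rewrite lt_min !ge_min !lexx orbT e10 subr_gt0.
  (* Five equally spaced parameters; the largest offset is [4r/5], so all stay within both
     neighbourhoods. *)
  pose a (i : nat) := t1 + i%:R * (r / 5).
  have Ha i : (i < 5)%N -> `|a i - t1| < r.
    move=> i5; rewrite /a addrC addKr normrM ger0_norm ?ler0n // gtr0_norm; last lra.
    rewrite mulrA ltr_pdivrMr // mulrC ltr_pM2l //.
    by rewrite ltr_nat.
  have Ha' i : (i < 5)%N -> `|a i - t| < e'.
    move=> /Ha Hi; have := ler_distD t1 (a i) t; lra.
  (* The local conic is the parametrized one here: its points, hence the whole arc around [t], lie
     on the fixed conic. *)
  have key : forall p, conic w0 x0 D w x p = 0 -> conic z0 y0 C z y p = 0.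
    apply: (@conic_unique _ _ _ _ _ _ _ _ _ _ _ [seq c (a i) | i <- iota 0 5]) => //.
      rewrite -map_comp map_inj_in_uniq ?iota_uniq // => i j.
      rewrite !mem_iota /= !add0n => Hi Hj.
      move=> /(Hu _ _ (Ha' _ Hi) (Ha' _ Hj)) /addrI.
      move=> /(mulIf _) E; apply/eqP; rewrite -(eqr_nat R); apply/eqP; apply: E.
      by rewrite gt_eqF //; lra.
    move=> p /mapP[i]; rewrite mem_iota /= add0n => Hi ->.
    have [? ?] := Hw _ (Ha' _ Hi); split => //.
    apply: He1; rewrite /ball /= distrC.
    by apply: lt_le_trans re1; exact: Ha.
  apply/nbhs_ballP; exists e' => //= r1; rewrite /ball /= distrC => Hr1.
  by apply: key; have [] := Hw _ Hr1.
exists 0; apply/nbhs_ballP; exists e => //= r; rewrite /ball /= distrC => Hr.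
by have [] := Hc _ Hr.
Qed.
End Global.

(** * From the open cover by chords to the ellipse *)

Theorem theorem4p7 (R : realType) (K : set (pt R)) (g1 g2 : R -> R)
  (U : set (pt R * pt R)) :
  convex_body K -> C2_regular_param K g1 g2 ->
  open_chord_set K U -> covers_bdry K U ->
  (forall s t, U (curve g1 g2 s, curve g1 g2 t) ->
     let d := psub (curve g1 g2 t) (curve g1 g2 s) in
     let alpha := line_angle (tangent g1 g2 s) d in
     let beta := line_angle (tangent g1 g2 t) d in
     curvature g1 g2 s <> 0 /\ curvature g1 g2 t <> 0 /\
     sin alpha ^+ 3 / curvature g1 g2 s = sin beta ^+ 3 / curvature g1 g2 t) ->
  is_ellipse K.
Proof.
move=> [Kc [_ K0]] [C1 [C2 [T0 [L [_ [_ [_ bK]]]]]]] [Uc Uo] Ucov HU.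
have bc s : bdry K (curve g1 g2 s) by apply/bK; exists s.
(* Openness among chords becomes a square of parameters, small enough that the endpoints stay
   distinct. *)
have UI s0 t0 : U (curve g1 g2 s0, curve g1 g2 t0) -> exists2 e : R, 0 < e &
    forall s t, `|s - s0| < e -> `|t - t0| < e -> chord_identity g1 g2 s t.
  move=> Ust; have [_ [_ st0]] := Uc _ Ust.
  have [e [e0 He]] := Uo _ Ust.
  have [es es0 Hs] := curve_near C1 C2 s0 e0.
  have [et et0 Ht] := curve_near C1 C2 t0 e0.
  have [en en0 Hn] := curve_neq_near C1 C2 st0.
  exists (Num.min es (Num.min et en)); first by rewrite !lt_min es0 et0.
  move=> s t; rewrite !lt_min => /and3P[s1 _ s3] /and3P[_ t2 t3].
  have st := Hn _ _ s3 t3.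
  have /HU[ks [kt E]] : U (curve g1 g2 s, curve g1 g2 t).
    exact: He _ _ (conj (bc s) (conj (bc t) st)) (Hs _ s1) (Ht _ t2).
  exact: chord_identity_of_angles.
have loc t0 : exists s0 : R, curve g1 g2 s0 <> curve g1 g2 t0 /\
    exists2 e : R, 0 < e &
    forall s t, `|s - s0| < e -> `|t - t0| < e -> chord_identity g1 g2 s t.
  have [q [Uq|Uq]] := Ucov _ (bc t0).
    have [_ [/bK[s0 sq] tq]] := Uc _ Uq; rewrite /= in sq tq.
    exists s0; rewrite sq; split; first by move=> /esym.
    rewrite -sq in Uq; have [e e0 He] := UI _ _ Uq.
    exists e; first exact: e0.
    move=> s t Hs Ht.
    have H := He t s Ht Hs.
    exact: (chord_identity_sym H).
  have [/bK[s0 sq] [_ tq]] := Uc _ Uq; rewrite /= in sq tq.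
  exists s0; rewrite sq; split => //.
  by rewrite -sq in Uq; exact: UI.
have [|z0 [y0 [C [z [y [zy Hc]]]]]] := @global_conic R g1 g2.
  move=> t0; have [s0 [st [e e0 He]]] := loc t0.
  have e20 : 0 < e / 2 by lra.
  have d0 : cross (tangent g1 g2 s0) (accel g1 g2 s0) != 0.
    by have [] := He s0 t0; rewrite ?subrr ?normr0.
  (* If the chord is tangent at [s0], a nearby [s1] replaces it; halving [e] keeps the ball around
     [s1] inside the one around [s0]. *)
  have [s1 Hs1 l0] := crossl_neq0_near C1 C2 e20 st d0.
  apply: (local_conic C1 C2 e20 _ l0) => s t Hs Ht; apply: He; last lra.
  by have := ler_distD s1 s s0; lra.
apply: (@conic_body_ellipse _ K z0 y0 C z y) => //.
by move=> p /bK[s <-].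
Qed.
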